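(* Let $X=\left(\{0,1,2,3\}\times\{0,1\}\right)^{\mathbb{N}}$ and $Y=\{0,1\}^{\mathbb{N}}$ be the one-sided full shifts with shift maps $T$ and $S$ respectively, and let $\pi\colon X\to Y$, $\pi\left((a_n,b_n)_{n\in\mathbb{N}}\right)=(b_n)_{n\in\mathbb{N}}$. Let $$I=\bigcup_{k=0}^{\infty}\left([4^k,2\cdot4^k)\cap\mathbb{N}\right),\qquad \Omega=\{(x_n)_{n\in\mathbb{N}}\in X\mid x_n=(0,0)\text{ for all } n\notin I\}.$$ Then $h_{\mathrm{FH}}^{1/2}(\Omega,T)=\log 2$. Consequently, $$\underline{h}_{\mathrm{top}}^{1/2}(\Omega,T)=\tfrac{2}{3}\log 2\ <\ h_{\mathrm{FH}}^{1/2}(\Omega,T)=\log 2\ <\ h_{\mathrm{top}}^{1/2}(\Omega,T)=\tfrac{4}{3}\log 2,$$ where the three weighted entropies (with weight $w=1/2$) are taken with respect to $\pi\colon(X,T)\to(Y,S)$.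
   Context: $\mathbb{N}=\{1,2,3,\dots\}$ and $\log$ is the natural logarithm. The metrics used are $\mathbf{d}(x,x')=2^{-\min\{n\geq1\mid x_n\neq x'_n\}}$ (and $0$ if $x=x'$) on $X$, and $\mathbf{d}'$ defined similarly on $Y$. Definitions, for an equivariant continuous map $\pi\colon(X,T)\to(Y,S)$ between compact metric dynamical systems ($\pi\circ T=S\circ\pi$) and a weight $0\leq w\leq1$: put $\mathbf{d}_n(x,x')=\max_{0\leq k<n}\mathbf{d}(T^kx,T^kx')$, $\mathbf{d}'_n(y,y')=\max_{0\leq k<n}\mathbf{d}'(S^ky,S^ky')$ (with $\mathbf{d}_0=0$), $$\mathbf{d}^w_n(x,x')=\max\left(\mathbf{d}_{\lceil wn\rceil}(x,x'),\ \mathbf{d}'_n(\pi(x),\pi(x'))\right),\qquad B^w_n(x,\varepsilon)=\{x'\in X\mid \mathbf{d}^w_n(x,x')<\varepsilon\}.$$ Feng--Huang entropy. For nonempty $\Omega\subset X$, $N\in\mathbb{N}$, $s\geq 0$, $\varepsilon>0$, let $\Lambda^{w,s}_{N,\varepsilon}(\Omega)=\inf\sum_i e^{-sn_i}$ over all at most countable coverings $\Omega\subset\bigcup_i B^w_{n_i}(x_i,\varepsilon)$ with $x_i\in X$ and integers $n_i\geq N$; let $\Lambda^{w,s}_{\varepsilon}(\Omega)=\lim_{N\to\infty}\Lambda^{w,s}_{N,\varepsilon}(\Omega)$. There is a unique critical value $h_{\mathrm{FH}}^w(\Omega,T,\varepsilon)\in[0,\infty]$ such that $\Lambda^{w,s}_\varepsilon(\Omega)=\infty$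 for $s<h_{\mathrm{FH}}^w(\Omega,T,\varepsilon)$ and $=0$ for $s>h_{\mathrm{FH}}^w(\Omega,T,\varepsilon)$. Define $h_{\mathrm{FH}}^w(\Omega,T)=\lim_{\varepsilon\to 0}h_{\mathrm{FH}}^w(\Omega,T,\varepsilon)$. Covering entropies. $\#(\Omega,\mathbf{d}_n,\varepsilon)$ is the smallest integer $k$ for which there are open subsets $U_1,\dots,U_k$ of $X$ covering $\Omega$ with $\mathrm{Diam}(U_i,\mathbf{d}_n)<\varepsilon$ for every $i$. Define $$\#^w(\Omega,n,\varepsilon)=\inf\sum_{j=1}^{\ell}\left(\#(\Omega\cap\pi^{-1}(V_j),\mathbf{d}_n,\varepsilon)\right)^w,$$ the infimum being over all finite families $V_1,\dots,V_\ell$ of open subsets of $Y$ with $\pi(\Omega)\subset V_1\cup\dots\cup V_\ell$ and $\mathrm{Diam}(V_j,\mathbf{d}'_n)<\varepsilon$ for every $j$; a term is $0$ whenever $\Omega\cap\pi^{-1}(V_j)=\emptyset$. Define $$h_{\mathrm{top}}^w(\Omega,T)=\lim_{\varepsilon\to0}\limsup_{n\to\infty}\frac{\log\#^w(\Omega,n,\varepsilon)}{n},\qquad \underline{h}_{\mathrm{top}}^w(\Omega,T)=\lim_{\varepsilon\to0}\liminf_{n\to\infty}\frac{\log\#^w(\Omega,n,\varepsilon)}{n}.$$ *)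

(* Defs.v *)
From HB Require Import structures.
From mathcomp Require Import all_boot all_order all_algebra.
From mathcomp Require Import all_classical all_reals all_analysis.

Set Implicit Arguments.
Unset Strict Implicit.
Unset Printing Implicit Defensive.

Import Order.TTheory GRing.Theory Num.Theory.
Import numFieldNormedType.Exports.

Local Open Scope classical_set_scope.
Local Open Scope ring_scope.

(* Sequences are indexed from 0: the coordinate x_n (n >= 1) of the usual
   notation is [x n.-1].  [R] is a phantom parameter, the type of the values
   of the metric. *)
Definition shift_space (R : realType) (A : finType) := nat -> A.

HB.instance Definition _ (R : realType) (A : finType) :=
  gen_eqMixin (shift_space R A).
HB.instance Definition _ (R : realType) (A : finType) :=
  gen_choiceMixin (shift_space R A).

Section shift_metric.
Context {R : realType} {A : finType}.
Implicit Types x y z : shift_space R A.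

(* 2 ^ - min {n >= 1 | x_n <> y_n}; the exponent is shifted by one because of
   the indexing from 0. *)
Definition shift_dist x y : R :=
  if pselect (exists n, x n != y n) is left neq_xy
  then 2 ^- (ex_minn neq_xy).+1 else 0.

Lemma shift_dist_ge0 x y : 0 <= shift_dist x y.
Proof.
by rewrite /shift_dist; case: pselect => // ?; rewrite invr_ge0 exprn_ge0.
Qed.

Lemma shift_dist_ltP x y m :
  reflect (forall i, (i < m)%N -> x i = y i) (shift_dist x y < 2 ^- m).
Proof.
rewrite /shift_dist; case: pselect => [xy|xy]; last first.
  rewrite invr_gt0 exprn_gt0//; apply: ReflectT => i _.
  by apply/eqP; apply: contrapT => /negP h; apply: xy; exists i.
case: ex_minnP => n xyn n_min.
rewrite ltf_pV2 ?posrE ?exprn_gt0// ltr_eXn2l ?ltr1n// ltnS.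
apply: (iffP idP) => [mn i im|h].
  apply/eqP; apply/negPn/negP => /n_min; rewrite leqNgt.
  by rewrite (leq_trans im mn).
by rewrite leqNgt; apply/negP => /h/eqP; exact/negP.
Qed.

Lemma shift_dist_leP x y m :
  reflect (forall i, (i < m)%N -> x i = y i) (shift_dist x y <= 2 ^- m.+1).
Proof.
rewrite /shift_dist; case: pselect => [xy|xy]; last first.
  rewrite invr_ge0 exprn_ge0//; apply: ReflectT => i _.
  by apply/eqP; apply: contrapT => /negP h; apply: xy; exists i.
case: ex_minnP => n xyn n_min.
rewrite lef_pV2 ?posrE ?exprn_gt0// ler_eXn2l ?ltr1n// ltnS.
apply: (iffP idP) => [mn i im|h].
  apply/eqP; apply/negPn/negP => /n_min; rewrite leqNgt.
  by rewrite (leq_trans im mn).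
by rewrite leqNgt; apply/negP => /h/eqP; exact/negP.
Qed.

Lemma shift_distxx x : shift_dist x x = 0.
Proof.
by rewrite /shift_dist; case: pselect => // xx;
  exfalso; case: xx => n; rewrite eqxx.
Qed.

Lemma shift_dist_positivity x y : shift_dist x y = 0 -> x = y.
Proof.
move=> xy0; apply/funext => n.
by apply/(@shift_dist_ltP _ _ n.+1) => //; rewrite xy0 invr_gt0 exprn_gt0.
Qed.

Lemma shift_dist_sym x y : shift_dist x y = shift_dist y x.
Proof.
suff le u v : shift_dist u v <= shift_dist v u.
  by apply/eqP; rewrite eq_le !le.
rewrite {2}/shift_dist; case: pselect => [vu|vu].
  case: ex_minnP => n _ n_min; apply/shift_dist_leP => i ni.
  apply/eqP; apply/negPn/negP; rewrite eq_sym => /n_min.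
  by rewrite leqNgt ni.
suff -> : u = v by rewrite shift_distxx.
apply/funext => i; apply/eqP; apply: contrapT => /negP uv.
by apply: vu; exists i; rewrite eq_sym.
Qed.

Lemma shift_dist_ultra y x z :
  shift_dist x z <= Num.max (shift_dist x y) (shift_dist y z).
Proof.
rewrite {1}/shift_dist; case: pselect => [xz|]; last first.
  by move=> _; rewrite le_max shift_dist_ge0.
case: ex_minnP => n xzn _; rewrite leNgt; apply/negP; rewrite gt_max.
by move=> /andP[/shift_dist_ltP/(_ n) xy /shift_dist_ltP/(_ n) yz];
  rewrite xy// yz// eqxx in xzn.
Qed.

Lemma shift_dist_triangle y x z :
  shift_dist x z <= shift_dist x y + shift_dist y z.
Proof.
rewrite (le_trans (shift_dist_ultra y x z))// ge_max.
by rewrite lerDl lerDr !shift_dist_ge0.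
Qed.

HB.instance Definition _ := @isMetric.Build R (shift_space R A) shift_dist
  shift_distxx shift_dist_positivity shift_dist_sym shift_dist_triangle.

Lemma mdist_shiftE x y : mdist x y = shift_dist x y.
Proof. by []. Qed.

Definition shift_map (x : shift_space R A) : shift_space R A := fun n => x n.+1.

End shift_metric.

Section bowen.
Context {R : realType} {X : metricType R} (T : X -> X).

Definition bowen_dist (n : nat) (x x' : X) : R :=
  \big[Num.max/0]_(k < n) mdist (iter k T x) (iter k T x').

(* In the extended reals, with diameter 0 for the empty set. *)
Definition bowen_diam (n : nat) (U : set X) : \bar R :=
  maxe 0%E (ereal_sup [set (bowen_dist n x x')%:E | x in U & x' in U]).

(* The infimum of a set of integers, hence a minimum, unless Omega has no such
   finite covering, in which case it is +oo. *)
Definition covering_number (Omega : set X) (n : nat) (eps : R) : \bar R :=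
  ereal_inf [set k%:R%:E | k in [set k : nat | exists U : 'I_k -> set X,
    [/\ forall i, open (U i), Omega `<=` \bigcup_i U i
      & forall i, (bowen_diam n (U i) < eps%:E)%E]]].

End bowen.

Section weighted_entropies.
Context {R : realType} {X Y : metricType R}.
Variables (T : X -> X) (S : Y -> Y) (pi : X -> Y) (w : R).
Implicit Types (Omega : set X) (n N : nat) (eps s : R).

Definition weighted_dist n (x x' : X) : R :=
  Num.max (bowen_dist T `|Num.ceil (w * n%:R)|%N x x')
          (bowen_dist S n (pi x) (pi x')).

Definition weighted_ball n (x : X) eps : set X :=
  [set x' | weighted_dist n x x' < eps].

(* An at most countable covering is a family indexed by a set J of naturals. *)
Definition FH_cover Omega N eps (J : set nat) (x : nat -> X) (n : nat -> nat) :=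
  (forall i, J i -> (N <= n i)%N) /\
  Omega `<=` \bigcup_(i in J) weighted_ball (n i) (x i) eps.

Definition FH_premeasure Omega N s eps : \bar R :=
  ereal_inf [set v : \bar R |
    exists (J : set nat) (x : nat -> X) (n : nat -> nat),
    FH_cover Omega N eps J x n /\
    v = \esum_(i in J) (expR (- s * (n i)%:R))%:E].

Definition FH_measure Omega s eps : \bar R :=
  limn (fun N => FH_premeasure Omega N s eps).

Definition FH_critical Omega eps (h : \bar R) : Prop :=
  (0 <= h)%E /\ forall s, 0 <= s ->
    ((s%:E < h)%E -> FH_measure Omega s eps = +oo%E) /\
    ((h < s%:E)%E -> FH_measure Omega s eps = 0%E).

(* The critical value; it exists and is unique, see [FH_critical_exists] and
   [FH_critical_unique]. *)
Definition FH_entropy_eps Omega eps : \bar R :=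
  xget 0%E [set h | FH_critical Omega eps h].

Definition FH_entropy Omega : \bar R :=
  lim (FH_entropy_eps Omega eps @[eps --> 0^'+]).

Definition weighted_covering_number Omega n eps : \bar R :=
  ereal_inf [set v : \bar R | exists (l : nat) (V : 'I_l -> set Y),
    [/\ forall j, open (V j), pi @` Omega `<=` \bigcup_j V j,
        forall j, (bowen_diam S n (V j) < eps%:E)%E
      & v = (\sum_(j < l)
              if `[< Omega `&` pi @^-1` V j = set0 >] then 0
              else covering_number T (Omega `&` pi @^-1` V j) n eps `^ w)%E]].

Definition upper_top_entropy Omega : \bar R :=
  lim (limn_esup (fun n =>
    (lne (weighted_covering_number Omega n eps) * (n%:R^-1)%:E)%E)
    @[eps --> 0^'+]).

Definition lower_top_entropy Omega : \bar R :=
  lim (limn_einf (fun n =>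
    (lne (weighted_covering_number Omega n eps) * (n%:R^-1)%:E)%E)
    @[eps --> 0^'+]).

Lemma FH_premeasure_ge0 Omega N s eps : (0 <= FH_premeasure Omega N s eps)%E.
Proof.
apply: le_ereal_inf_tmp => _ [J [x [n [_ ->]]]].
by apply: esum_ge0 => i _; rewrite lee_fin expR_ge0.
Qed.

Lemma FH_premeasure_nondecreasing Omega s eps :
  nondecreasing_seq (fun N => FH_premeasure Omega N s eps).
Proof.
move=> M N MN; apply: ereal_inf_le_tmp => _ [J [x [n [[nN cov] ->]]]].
exists J, x, n; split => //; split => // i /nN; exact: leq_trans MN.
Qed.

Lemma FH_premeasure_cvg Omega s eps :
  cvgn (fun N => FH_premeasure Omega N s eps).
Proof.
exact: ereal_nondecreasing_is_cvgn (FH_premeasure_nondecreasing _ _ _).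
Qed.

Lemma FH_premeasure_le Omega s eps N :
  (FH_premeasure Omega N s eps <= FH_measure Omega s eps)%E.
Proof.
rewrite /FH_measure.
have nd := @FH_premeasure_nondecreasing Omega s eps.
rewrite (cvg_lim _ (ereal_nondecreasing_cvgn nd))//.
by apply: ereal_sup_ubound; exists N.
Qed.

Lemma FH_premeasure_decay Omega s t eps N : s <= t ->
  (FH_premeasure Omega N t eps <=
   (expR (- (t - s) * N%:R))%:E * FH_premeasure Omega N s eps)%E.
Proof.
move=> st; set c := expR _; have c0 : 0 < c by exact: expR_gt0.
rewrite -lee_pdivrMl//.
apply: le_ereal_inf_tmp => _ [J [x [n [[nN cov] ->]]]].
rewrite lee_pdivrMl//.
apply: (@le_trans _ _ (\esum_(i in J) (expR (- t * (n i)%:R))%:E)).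
  by apply: ge_ereal_inf; eexists; last exact: lexx; exists J, x, n.
apply: ge_ereal_sup => _ [F [finF FJ] <-].
apply: (@le_trans _ _ (c%:E * \sum_(i \in F) (expR (- s * (n i)%:R))%:E)%E).
  rewrite ge0_mule_fsumr; last by move=> i; rewrite lee_fin expR_ge0.
  apply: lee_fsum => // i Fi.
  rewrite lee_fin -expRD ler_expR -lerBlDr !mulNr opprK addrC -mulrBl.
  rewrite -(opprB t s) mulNr lerN2 ler_wpM2l ?subr_ge0// ler_nat.
  exact/nN/FJ.
apply: lee_wpmul2l; first by rewrite lee_fin ltW.
by apply: ereal_sup_ubound; exists F.
Qed.

Lemma FH_measure_ge0 Omega s eps : (0 <= FH_measure Omega s eps)%E.
Proof.
exact: le_trans (FH_premeasure_ge0 _ _ _ _) (FH_premeasure_le _ _ _ 0%N).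
Qed.

Lemma FH_measure_eq0 Omega s t eps : s < t ->
  (FH_measure Omega s eps < +oo -> FH_measure Omega t eps = 0)%E.
Proof.
move=> st Ms; set M := FH_measure Omega s eps in Ms.
have Mfin : M \is a fin_num by rewrite ge0_fin_numE// FH_measure_ge0.
have M0 : (0 <= M)%E by exact: FH_measure_ge0.
apply/eqP; rewrite eq_le FH_measure_ge0 andbT.
have cvg0 : (expR (- (t - s) * N%:R) * fine M)%:E @[N --> \oo] --> (0 : \bar R).
  apply: cvg_EFin; first exact: nearW.
  rewrite -(mul0r (fine M)); apply: cvgMr_tmp.
  under eq_fun do rewrite expRM_natr.
  by apply: cvg_expr; rewrite ger0_norm ?expR_ge0// expR_lt1 oppr_lt0 subr_gt0.
rewrite -(cvg_lim (@ereal_hausdorff _) cvg0).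
apply: lee_lim; first exact: FH_premeasure_cvg.
  by apply/cvg_ex; exists 0%E.
near=> N; rewrite (le_trans (FH_premeasure_decay _ _ _ (ltW st)))//.
by rewrite EFinM fineK// lee_wpmul2l ?lee_fin ?expR_ge0// FH_premeasure_le.
Unshelve. all: by end_near. Qed.

Lemma FH_critical_exists Omega eps : exists h, FH_critical Omega eps h.
Proof.
pose Z := [set s%:E | s in [set s | 0 <= s /\ FH_measure Omega s eps = 0%E]].
exists (ereal_inf Z); split.
  by apply: le_ereal_inf_tmp => _ [s [s0 _] <-]; rewrite lee_fin.
move=> s s0; split=> [sZ|/ereal_inf_lt[_ [r [r0 r_0] <-]]]; last first.
  by rewrite lte_fin => rs; apply: (FH_measure_eq0 rs); rewrite r_0 ltry.
apply/eqP; rewrite -leye_eq leNgt; apply/negP => Ms.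
have lbZ t : s < t -> (ereal_inf Z <= t%:E)%E.
  move=> st; apply: ereal_inf_lbound; exists t => //; split.
    exact: le_trans (ltW st).
  exact: FH_measure_eq0 Ms.
move: sZ; rewrite ltNge => /negP; apply.
by apply/lee_addgt0Pr => e e0; rewrite -EFinD lbZ// ltrDl.
Qed.

Lemma FH_critical_unique Omega eps h h' :
  FH_critical Omega eps h -> FH_critical Omega eps h' -> h = h'.
Proof.
suff le k k' : FH_critical Omega eps k -> FH_critical Omega eps k' ->
    (k <= k')%E.
  by move=> ch ch'; apply/eqP; rewrite eq_le !le.
move=> [_ ck] [k'0 ck']; rewrite leNgt; apply/negP => k'k.
have [r k'r rk] : exists2 r : R, (k' < r%:E)%E & (r%:E < k)%E.
  case: k' k'0 k'k {ck'} => [a _|_|//]; last by rewrite ltNge leey.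
  case: k {ck} => [b|_|//].
    rewrite lte_fin => ab; exists ((a + b) / 2); rewrite lte_fin.
      exact: (midf_lt ab).1.
    exact: (midf_lt ab).2.
  by exists (a + 1); rewrite ?ltry// lte_fin ltrDl.
have r0 : 0 <= r by rewrite -lee_fin (le_trans k'0)// ltW.
have := (ck _ r0).1 rk; by rewrite (ck' _ r0).2.
Qed.

Lemma FH_entropy_epsP Omega eps :
  FH_critical Omega eps (FH_entropy_eps Omega eps).
Proof.
have [h hP] := FH_critical_exists Omega eps.
exact: (xgetI (P := [set k | FH_critical Omega eps k]) _ hP).
Qed.

End weighted_entropies.

Definition proj_snd (R : realType) (x : shift_space R ('I_4 * 'I_2)%type) :
  shift_space R 'I_2 := fun n => (x n).2.
Arguments proj_snd R x : clear implicits.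

Definition free_positions : set nat :=
  [set n | exists k, (4 ^ k <= n < 2 * 4 ^ k)%N].

(* [x i] is the coordinate x_{i+1}. *)
Definition block_set (R : realType) : set (shift_space R ('I_4 * 'I_2)%type) :=
  [set x | forall i, ~ free_positions i.+1 -> x i = (ord0, ord0)].
Arguments block_set R : clear implicits.

(* Main.v *)
Require Import Defs.
From mathcomp Require Import all_boot all_order all_algebra.
From mathcomp Require Import all_classical all_reals all_analysis.
From mathcomp Require Import zify lra.

(** Everything reduces to counting words.  Call a position free when it belongs
to [I], and let [c n] be the number of free positions among [1, .., n].  In
[Omega], a free position carries three bits, two in the first component and
one in the second, and the other positions carry none.

At a scale [eps] with [2 ^- p.+2 < eps <= 2 ^- p.+1], Bowen distance [< eps] at
time [n] means agreement of the first [n + p] symbols ([bowen_dist_lt]).  Hence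
a weighted ball of order [n] fixes the first [a = uphalf n + p] symbols, and the
second components of the first [b = n + p] symbols: it fixes [2 * c a + c b] of
the free bits.

The key fact is that a position [i] is free exactly when [trunc_log 2 i] is
even, so that, for [i >= 2], exactly one of [i] and [i./2] is free
([free_at_double]).  Counting the positions up to [n] according to which of the
two alternatives holds gives the recursion [c (2k+1) + 2 * c k = 2k+1], from
which the rest follows:
- [2 * c (n./2) + c n] is [n] or [n + 1], so a weighted ball of order [n]
  centred in [Omega] occupies a proportion [2 ^- n] of [Omega], up to a factor
  depending only on the scale.  The equidistributed measure on [Omega] is thus comparable with the
  Feng-Huang premeasures at [s = ln 2], and the Feng-Huang entropy is [ln 2] at
  every small scale ([FH_entropy_epsE]).  The lower bound replaces that measure
  by counts of words, after extracting a finite subcover ([finite_subcover],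
  [finite_mass_distribution]).
- [n <= 3 * c n <= 2n + 1], where each bound is attained for arbitrarily large
  [n].  The optimal weighted covering consists of the [2 ^ c N] cylinders of
  length [N = n + p] of [pi Omega], each with a fibre of [4 ^ c N] words that
  counts for its square root; so the weighted covering number is [4 ^ c (n + p)]
  ([weighted_covering_numberE]), and its exponential growth rate has lower limit
  [2 / 3 * ln 2] and upper limit [4 / 3 * ln 2].

Since each entropy is independent of the scale once [eps <= 1 / 2], the limits
as [eps] tends to [0] are immediate ([lim_scale]). *)

Set Implicit Arguments.
Unset Strict Implicit.
Unset Printing Implicit Defensive.

Import Order.TTheory GRing.Theory Num.Theory.
Import numFieldNormedType.Exports.

(** * Free positions and their number *)

(** The blocks [4 ^ k, 2 * 4 ^ k) are the dyadic blocks of even index; the parity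
of the logarithm makes membership decidable and compatible with halving. *)
Definition free_at (i : nat) : bool := ~~ odd (trunc_log 2 i).
Definition nfree (n : nat) : nat := \sum_(i < n) free_at i.+1.

Lemma free_atP i : 0 < i ->
  reflect (exists k, 4 ^ k <= i < 2 * 4 ^ k) (free_at i).
Proof.
move=> i0; have e4 k : 4 ^ k = 2 ^ k.*2 by rewrite -muln2 mulnC expnM.
apply: (iffP idP) => [fi|[k]]; last first.
  rewrite e4 -expnS /free_at => /(@trunc_log_eq 2 _ _ isT) ->.
  by rewrite odd_double.
exists (trunc_log 2 i)./2; rewrite e4 -expnS.
have -> : (trunc_log 2 i)./2.*2 = trunc_log 2 i by rewrite even_halfK.
by rewrite trunc_logP// trunc_log_ltn.
Qed.

Lemma free_at_double (b : bool) i : 0 < i -> free_at (b + i.*2) = ~~ free_at i.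
Proof.
move=> i0; rewrite /free_at -[in RHS](half_bit_double i b).
by rewrite [in LHS]trunc_log2S /= ?negbK; [ | lia].
Qed.

Lemma nfree0 : nfree 0 = 0.
Proof. by rewrite /nfree big_ord0. Qed.

Lemma nfreeS n : nfree n.+1 = nfree n + free_at n.+1.
Proof. by rewrite /nfree big_ord_recr. Qed.

Lemma nfree_leD n m : nfree n <= nfree (n + m) <= nfree n + m.
Proof.
by elim: m => [|m IH]; rewrite ?addnS ?nfreeS ?addn0 ?leqnn//; lia.
Qed.

(** For [k > 0], the positions [2k] and [2k+1] are both free or both constrained,
according to whether [k] is constrained or free. *)
Lemma nfree_double_add1 k : nfree k.*2.+1 + (nfree k).*2 = k.*2.+1.
Proof.
elim: k => [|k IH]; first by rewrite nfreeS /nfree big_ord0.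
rewrite doubleS 2!nfreeS [nfree k.+1]nfreeS.
have := @free_at_double false k.+1 isT; have := @free_at_double true k.+1 isT.
rewrite doubleS !add0n => -> ->; move: IH; case: (free_at k.+1) => /=; lia.
Qed.

Lemma nfree_double k : 0 < k -> nfree k.*2 + (nfree k).*2 = k.*2 + free_at k.
Proof.
case: k => // k _; have := nfree_double_add1 k.
rewrite doubleS (nfreeS k.*2.+1) (nfreeS k).
by have := @free_at_double false k.+1 isT; rewrite doubleS !add0n => ->;
  case: (free_at k.+1) => /=; lia.
Qed.

Lemma nfree_bounds n : n <= 3 * nfree n <= n.*2.+1.
Proof.
elim/ltn_ind: n => -[|n] IH; first by rewrite nfree0.
rewrite -(odd_double_half n) in IH *; move: IH; set k := n./2.
case: (odd n) => IH /=.
  have IHk := IH k ltac:(lia); have IHk1 := IH k.+1 ltac:(lia).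
  have := nfree_double (ltn0Sn k); have := nfreeS k.
  by rewrite add1n -doubleS; lia.
have IHk := IH k ltac:(lia).
by have := nfree_double_add1 k; rewrite add0n; lia.
Qed.

(** The set [I] is designed for this: the two components, read up to times
[n / 2] and [n], always contain [n] free bits altogether, up to one.  This is
why the Feng-Huang entropy does not see the oscillation of [nfree n / n]. *)
Lemma nfree_weighted n : n <= (nfree n./2).*2 + nfree n <= n.+1.
Proof.
case: n => [|n]; first by rewrite !nfree0.
set m := n.+1; rewrite -[in nfree m](odd_double_half m).
have := @nfree_double m./2; have := nfree_double_add1 m./2.
case: (odd m) (odd_double_half m) => /=; rewrite ?add1n ?add0n; lia.
Qed.

(** The map [n |-> 2n+1] exchanges the two extremal cases, as it sends the last
position before a free block to the last position of that block, and the latter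
to the last position before the next free block. *)
Lemma nfree_extremal N :
  (exists2 n, N <= n & 3 * nfree n = n) /\
  (exists2 n, N <= n & 3 * nfree n = n.*2.+1).
Proof.
elim: N => [|N [[n Nn n_min] [m Nm m_max]]].
  split; first by exists 0 => //; rewrite nfree0.
  by exists 1 => //; rewrite nfreeS nfree0.
split.
  by exists m.*2.+1; [lia | have := nfree_double_add1 m; lia].
by exists n.*2.+1; [lia | have := nfree_double_add1 n; lia].
Qed.

Local Open Scope classical_set_scope.
Local Open Scope ring_scope.

(** * Bowen metrics on shift spaces *)

Definition agree (A : Type) (n : nat) (x y : nat -> A) :=
  forall i, (i < n)%N -> x i = y i.

Section metric.
Context {R : realType} {A : finType}.
Implicit Types (x y : shift_space R A) (U : set (shift_space R A)) (eps : R).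

(** The nonzero distances are powers of [2], so that a distance is [< eps] exactly
when it is [<= 2 ^- p.+2]: only the integer [p] matters. *)
Definition scale_of eps p := 2 ^- p.+2 < eps <= 2 ^- p.+1.

Lemma scale_exists eps : 0 < eps -> eps <= 2^-1 -> exists p, scale_of eps p.
Proof.
move=> eps0 eps2; pose P q := 2 ^- q < eps.
have exP : exists q, P q.
  exists (Num.bound eps^-1); rewrite /P invf_plt ?posrE ?exprn_gt0//.
  exact: upper_nthrootP.
case: (ex_minnP exP) => -[|[|p]] Pp p_min.
- by move: Pp; rewrite /P expr0 invr1; lra.
- by move: Pp; rewrite /P expr1; lra.
exists p; apply/andP; split=> //; rewrite leNgt; apply/negP => /p_min.
by rewrite ltnn.
Qed.

Lemma iter_shift_map n x i : iter n shift_map x i = x (n + i)%N.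
Proof. by elim: n i => //= n IH i; rewrite /shift_map IH addnS. Qed.

(** The bound is [2 ^- p.+2] rather than [eps], in order to survive the supremum
in the diameter with a strict inequality. *)
Lemma bowen_dist_le n p x y : agree (n + p) x y ->
  bowen_dist shift_map n x y <= 2 ^- p.+2.
Proof.
move=> xy; apply/bigmax_leP; split => [|k _].
  by rewrite invr_ge0 exprn_ge0.
rewrite mdist_shiftE; apply/shift_dist_leP => i ip.
by rewrite !iter_shift_map xy//; have := ltn_ord k; lia.
Qed.

Lemma bowen_dist_lt n p eps x y : (0 < n)%N -> scale_of eps p ->
  bowen_dist shift_map n x y < eps <-> agree (n + p) x y.
Proof.
move=> n0 /andP[eps_gt eps_le]; split => [xy i inp|]; last first.
  by move=> /bowen_dist_le xy; exact: le_lt_trans xy eps_gt.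
(* Position [i] is seen at distance at most [p] from the time [minn i n.-1]. *)
have kn : (minn i n.-1 < n)%N by lia.
have : shift_dist (iter (Ordinal kn) shift_map x)
    (iter (Ordinal kn) shift_map y) < 2 ^- p.+1.
  apply: lt_le_trans eps_le; apply: le_lt_trans xy.
  exact: (le_bigmax_cond _ (fun k : 'I_n => mdist (iter k shift_map x)
    (iter k shift_map y))).
move=> /shift_dist_ltP/(_ (i - minn i n.-1)%N); rewrite !iter_shift_map /=.
by rewrite subnKC ?geq_minl//; apply; lia.
Qed.

Lemma bowen_diam_lt n p eps U : (0 < n)%N -> scale_of eps p ->
  (bowen_diam shift_map n U < eps%:E)%E <->
  (forall x y, U x -> U y -> agree (n + p) x y).
Proof.
move=> n0 eps_p; split => [Ueps x y Ux Uy|U_agree].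
  apply/(bowen_dist_lt _ _ n0 eps_p); rewrite -lte_fin.
  apply: le_lt_trans Ueps; rewrite /bowen_diam le_max; apply/orP; right.
  by apply: ereal_sup_ubound; exists x => //; exists y.
apply: (@le_lt_trans _ _ (2 ^- p.+2)%:E); last first.
  by rewrite lte_fin; case/andP: eps_p.
rewrite /bowen_diam ge_max lee_fin invr_ge0 exprn_ge0//=.
apply: ge_ereal_sup => _ [x Ux [y Uy <-]]; rewrite lee_fin.
exact/bowen_dist_le/U_agree.
Qed.

Lemma open_agree n x : open ([set y | agree n x y] : set (shift_space R A)).
Proof.
rewrite openE => y xy; apply/nbhs_ballP.
exists (2 ^- n) => /=; first by rewrite invr_gt0 exprn_gt0.
move=> z; rewrite ballEmdist /= mdist_shiftE => /shift_dist_ltP yz i ni.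
by rewrite xy// yz.
Qed.

End metric.

Lemma ceil_half (R : realType) n : `|Num.ceil (2^-1 * n%:R : R)|%N = uphalf n.
Proof.
rewrite (@ceil_def _ _ (uphalf n)%:Z) ?absz_nat//.
have : (uphalf n + uphalf n = n + odd n)%N.
  by rewrite addnn -[in RHS](odd_double_half n) uphalf_half; lia.
move=> /(congr1 (fun k => k%:R : R)); rewrite !natrD => e.
have := leq_b1 (odd n); rewrite -(ler_nat R) => odd1.
have := ler0n R (odd n) => odd0.
rewrite intrD -!pmulrn mulrN1z.
by apply/andP; split; lra.
Qed.

(** * Finite words *)

Section finite_words.
Context {A : finType}.
Implicit Types (x y : nat -> A).

Definition truncate N x : {ffun 'I_N -> A} := [ffun i => x (nat_of_ord i)].

Definition pad (a0 : A) N (w : {ffun 'I_N -> A}) : nat -> A :=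
  fun i => if insub i is Some j then w j else a0.

Lemma pad_ord a0 N (w : {ffun 'I_N -> A}) (i : 'I_N) : pad a0 w i = w i.
Proof. by rewrite /pad valK. Qed.

Lemma pad_out a0 N (w : {ffun 'I_N -> A}) i : (N <= i)%N -> pad a0 w i = a0.
Proof. by move=> Ni; rewrite /pad insubF// ltnNge Ni. Qed.

Lemma pad_in a0 N (w : {ffun 'I_N -> A}) i (iN : (i < N)%N) :
  pad a0 w i = w (Ordinal iN).
Proof. exact: (pad_ord a0 w (Ordinal iN)). Qed.

Lemma truncate_pad a0 N (w : {ffun 'I_N -> A}) : truncate N (pad a0 w) = w.
Proof. by apply/ffunP => i; rewrite ffunE pad_ord. Qed.

Lemma agree_truncate N x y : agree N x y <-> truncate N x = truncate N y.
Proof.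
split=> [xy|/ffunP xy i iN]; first by apply/ffunP => i; rewrite !ffunE xy.
by have := xy (Ordinal iN); rewrite !ffunE.
Qed.

Lemma agree_pad_truncate a0 N x : agree N (pad a0 (truncate N x)) x.
Proof. by apply/agree_truncate; rewrite truncate_pad. Qed.

Lemma card_family_prod N (F : 'I_N -> pred A) :
  #|(family F : simpl_pred {ffun 'I_N -> A})| = (\prod_(i < N) #|F i|)%N.
Proof. by rewrite card_family foldrE big_map big_enum. Qed.

Lemma card_family_le N (F : 'I_N -> pred A) (e : nat -> nat) :
  (forall i : 'I_N, #|F i| <= 2 ^ e i)%N ->
  (#|(family F : simpl_pred {ffun 'I_N -> A})| <= 2 ^ (\sum_(i < N) e i))%N.
Proof.
by move=> Fe; rewrite card_family_prod expn_sum; apply: leq_prod => i _.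
Qed.

Lemma card_family_eq N (F : 'I_N -> pred A) (e : nat -> nat) :
  (forall i : 'I_N, #|F i| = 2 ^ e i)%N ->
  (#|(family F : simpl_pred {ffun 'I_N -> A})| = 2 ^ (\sum_(i < N) e i))%N.
Proof.
by move=> Fe; rewrite card_family_prod expn_sum; apply: eq_bigr => i _.
Qed.

End finite_words.

(** * Compactness *)

(** Koenig's lemma: call a cylinder bad when no finite subfamily covers its
intersection with [K]; a bad cylinder has a bad extension by one letter, and an
infinite branch of bad cylinders converges to a point of [K] that some [B i]
contains together with a whole cylinder around it, which is then not bad. *)
Lemma finite_subcover (A : finType) (K : set (nat -> A)) (J : set nat)
    (B : nat -> set (nat -> A)) (len : nat -> nat) :
  (forall x, (forall m, exists2 y, K y & agree m x y) -> K x) ->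
  (forall i x y, J i -> agree (len i) x y -> B i x -> B i y) ->
  K `<=` \bigcup_(i in J) B i ->
  exists F : set nat, [/\ finite_set F, F `<=` J & K `<=` \bigcup_(i in F) B i].
Proof.
move=> K_closed B_open KB; apply: contrapT => no_cover.
pose bad m x := ~ exists F : set nat, [/\ finite_set F, F `<=` J &
  (K `&` [set y | agree m x y]) `<=` \bigcup_(i in F) B i].
have bad_ext m x : bad m x -> exists y, agree m x y /\ bad m.+1 y.
  move=> badx; apply: contrapT => noy; apply: badx.
  pose upd a : nat -> A := fun i => if i == m then a else x i.
  have updE a : exists F : set nat, [/\ finite_set F, F `<=` J &
      (K `&` [set y | agree m.+1 (upd a) y]) `<=` \bigcup_(i in F) B i].
    apply: contrapT => nF; apply: noy; exists (upd a); split=> // i im.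
    by rewrite /upd ltn_eqF.
  have [F FP] := choice updE.
  exists (\bigcup_(a in [set: A]) F a); split.
  - by apply: bigcup_finite => [|a _]; [exact: finite_finset | case: (FP a)].
  - by apply: bigcup_sub => a _; case: (FP a).
  move=> y [Ky xy]; have [_ _ /(_ y)] := FP (y m).
  case=> [|i Fi Bi]; last by exists i => //; exists (y m).
  split=> // i; rewrite ltnS /upd => im.
  by case: eqVneq => [->//|i_neq]; apply: xy; rewrite ltn_neqAle i_neq.
have [z z_bad] : exists z, bad 0%N z.
  have [[x Kx]|K0] := pselect (exists x, K x).
    exists x => -[F [finF FJ cov]]; apply: no_cover; exists F; split=> // y Ky.
    by apply: cov; split.
  by case: no_cover; exists set0; split=> // x Kx; case: K0; exists x.
pose S := {mx : nat * (nat -> A) | bad mx.1 mx.2}.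
have next (s : S) : exists s' : S, (sval s').1 = (sval s).1.+1 /\
    agree (sval s).1 (sval s).2 (sval s').2.
  case: s => -[m x] /= badx; have [y [xy bady]] := bad_ext _ _ badx.
  by exists (exist (fun mx => bad mx.1 mx.2) (m.+1, y) bady).
have [f fP] := choice next.
pose s0 : S := exist (fun mx => bad mx.1 mx.2) (0%N, z) z_bad.
pose u n := sval (iter n f s0).
have u1 n : (u n).1 = n.
  elim: n => // n IH; have [e _] := fP (iter n f s0).
  by rewrite /u iterS e -/(u n) IH.
have u2 n k : agree n (u n).2 (u (k + n)%N).2.
  elim: k => // k IH i im; rewrite IH// addSn.
  have [_] := fP (iter (k + n) f s0); rewrite -/(u _) u1 => -> //.
  by rewrite (leq_trans im)// leq_addl.
pose x i := (u i.+1).2 i.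
have xu n : agree n (u n).2 x.
  by move=> i im; rewrite /x (u2 i.+1 (n - i.+1)%N)// subnK.
have x_bad n : bad n x.
  have := svalP (iter n f s0); rewrite -/(u n) u1 => badu [F [finF FJ cov]].
  apply: badu; exists F; split=> // y [Ky uy]; apply: cov; split=> // i im.
  by rewrite -(xu n)// uy.
have Kx : K x.
  apply: K_closed => m; apply: contrapT => noy; apply: (x_bad m).
  by exists set0; split=> // y [Ky xy]; case: noy; exists y.
have [i Ji Bi] := KB _ Kx; apply: (x_bad (len i)).
exists [set i]; split; first exact: finite_set1.
  by move=> _ ->.
by move=> y [_ xy]; exists i => //; apply: B_open xy Bi.
Qed.

(** * Counting the words of the block set *)

Definition sym0 : 'I_4 * 'I_2 := (ord0, ord0).

Lemma card_snd (t : 'I_2) : #|[pred z : 'I_4 * 'I_2 | z.2 == t]| = 4.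
Proof.
transitivity #|[predX 'I_4 & pred1 t]|.
  by apply: eq_card => -[u v]; rewrite !inE.
by rewrite cardX card1 card_ord.
Qed.

Lemma card_fst (t : 'I_4) : #|[pred z : 'I_4 * 'I_2 | z.1 == t]| = 2.
Proof.
transitivity #|[predX pred1 t & 'I_2]|.
  by apply: eq_card => -[u v]; rewrite !inE andbT.
by rewrite cardX card1 card_ord.
Qed.

(** The letters allowed at position [i] for a point of the block set that agrees
with [x] on the first [a] symbols, and whose projection agrees with that of [x]
on the first [b] symbols. *)
Definition cyl_constr (x : nat -> 'I_4 * 'I_2) (a b i : nat) :
    pred ('I_4 * 'I_2) :=
  [pred z | [&& free_at i.+1 || (z == sym0), (i < a)%N ==> (z == x i)
    & (i < b)%N ==> (z.2 == (x i).2)]].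

(** Number of bits left undetermined at position [i]. *)
Definition cyl_constr_expo (a b i : nat) : nat :=
  (free_at i.+1 * (2 * (a <= i) + (b <= i)))%N.

Lemma card_cyl_constr_eq x a b i :
  (a <= b)%N -> free_at i.+1 || (x i == sym0) ->
  #|cyl_constr x a b i| = (2 ^ cyl_constr_expo a b i)%N.
Proof.
move=> ab xi; rewrite /cyl_constr_expo.
case: (boolP (free_at i.+1)) xi => [fi _|fi /= /eqP xi]; last first.
  rewrite mul0n expn0; transitivity #|pred1 sym0|; last exact: card1.
  apply: eq_card => z; rewrite !inE (negbTE fi) /= xi.
  by case: eqVneq => //= ->; rewrite eqxx !implybT.
rewrite mul1n; case: (ltnP i a) => ia.
  have ib := leq_trans ia ab; rewrite leqNgt ib.
  transitivity #|pred1 (x i)|; last exact: card1.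
  apply: eq_card => z; rewrite !inE fi ia ib /=.
  by case: eqVneq => //= ->; rewrite eqxx.
case: (ltnP i b) => ib.
  transitivity #|[pred z : 'I_4 * 'I_2 | z.2 == (x i).2]|; last exact: card_snd.
  by apply: eq_card => z; rewrite !inE fi ltnNge ia ib.
transitivity #|{: 'I_4 * 'I_2}|; last by rewrite card_prod !card_ord.
by apply: eq_card => z; rewrite !inE fi !ltnNge ia ib.
Qed.

Lemma card_cyl_constr_le x a b i : (a <= b)%N ->
  (#|cyl_constr x a b i| <= 2 ^ cyl_constr_expo a b i)%N.
Proof.
move=> ab; have [|/norP[fi xi]] := boolP (free_at i.+1 || (x i == sym0)).
  by move=> /(card_cyl_constr_eq ab) ->.
rewrite /cyl_constr_expo (negbTE fi) mul0n expn0.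
apply: (@leq_trans #|pred1 sym0|); last by rewrite card1.
apply: subset_leq_card; apply/fintype.subsetP => z.
by rewrite !inE (negbTE fi) => /andP[].
Qed.

Lemma nfree_widen a M : (a <= M)%N ->
  nfree a = (\sum_(i < M) (i < a) * free_at i.+1)%N.
Proof.
move=> aM; rewrite /nfree (big_ord_widen M (fun i => free_at i.+1 : nat))//.
rewrite big_mkcond.
by apply: eq_bigr => i _; case: (i < a)%N; rewrite ?mul1n.
Qed.

Lemma sum_cyl_constr_expo a b M : (a <= M)%N -> (b <= M)%N ->
  (\sum_(i < M) cyl_constr_expo a b i + (2 * nfree a + nfree b)
    = 3 * nfree M)%N.
Proof.
move=> aM bM; rewrite (nfree_widen aM) (nfree_widen bM) /nfree !big_distrr /=.
rewrite -!big_split /=; apply: eq_bigr => i _; rewrite /cyl_constr_expo.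
by case: (free_at _); case: (ltnP i a); case: (ltnP i b).
Qed.

Definition cyl_words N x a b : pred {ffun 'I_N -> 'I_4 * 'I_2} :=
  family (fun i : 'I_N => cyl_constr x a b i).

(** The product form avoids truncated subtraction in the exponent: among the
[3 * nfree N] free bits of a word of length [N], [2 * nfree a + nfree b] are
fixed.  There may be no such word, when [x] is not in the block set. *)
Lemma card_cyl_words_le N x a b : (a <= b <= N)%N ->
  (#|cyl_words x a b : pred {ffun 'I_N -> _}| * 2 ^ (2 * nfree a + nfree b)
    <= 2 ^ (3 * nfree N))%N.
Proof.
move=> /andP[ab bN]; rewrite -(sum_cyl_constr_expo (leq_trans ab bN) bN).
rewrite [leqRHS]expnD leq_mul2r expn_eq0 /=.
apply: (card_family_le (e := cyl_constr_expo a b)).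
by move=> i; apply: card_cyl_constr_le.
Qed.

Lemma card_cyl_words_eq N x a b : (a <= b <= N)%N ->
  (forall i, (i < N)%N -> free_at i.+1 || (x i == sym0)) ->
  (#|cyl_words x a b : pred {ffun 'I_N -> _}| * 2 ^ (2 * nfree a + nfree b)
    = 2 ^ (3 * nfree N))%N.
Proof.
move=> /andP[ab bN] xP; rewrite -(sum_cyl_constr_expo (leq_trans ab bN) bN).
rewrite [in RHS]expnD.
congr muln; apply: (card_family_eq (e := cyl_constr_expo a b)).
by move=> i; apply: card_cyl_constr_eq => //; apply: xP.
Qed.

(** Canonical centres of the weighted balls: the first component, which a ball
does not see at the positions [i >= a], is set to [0] there. *)
Definition ball_constr (a i : nat) : pred ('I_4 * 'I_2) :=
  [pred z | (free_at i.+1 || (z == sym0)) && ((a <= i)%N ==> (z.1 == ord0))].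

Definition ball_words N a : pred {ffun 'I_N -> 'I_4 * 'I_2} :=
  family (fun i : 'I_N => ball_constr a i).

Lemma card_ball_words N a : (a <= N)%N ->
  #|ball_words a : pred {ffun 'I_N -> _}| = (2 ^ (2 * nfree a + nfree N))%N.
Proof.
move=> aN; pose e i : nat := (free_at i.+1 * (2 * (i < a) + 1))%N.
rewrite (card_family_eq (e := e)) => [|i].
  congr expn; rewrite (nfree_widen aN) /nfree big_distrr -big_split /=.
  by apply: eq_bigr => i _; rewrite /e mulnDr muln1 mulnC -mulnA.
rewrite /e; case: (boolP (free_at i.+1)) => fi; last first.
  rewrite mul0n expn0; transitivity #|pred1 sym0|; last exact: card1.
  apply: eq_card => z; rewrite !inE (negbTE fi) /=.
  by case: eqVneq => //= ->; rewrite eqxx !implybT.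
rewrite mul1n; case: (ltnP i a) => ia.
  transitivity #|{: 'I_4 * 'I_2}|; last by rewrite card_prod !card_ord.
  by apply: eq_card => z; rewrite !inE fi leqNgt ia.
transitivity #|[pred z : 'I_4 * 'I_2 | z.1 == ord0]|; last exact: card_fst.
by apply: eq_card => z; rewrite !inE fi ia.
Qed.

Definition base_words N : pred {ffun 'I_N -> 'I_2} :=
  family (fun i : 'I_N => [pred t | free_at i.+1 || (t == ord0)]).

Lemma card_base_words N : #|@base_words N| = (2 ^ nfree N)%N.
Proof.
apply: (card_family_eq (e := fun i => free_at i.+1)) => i /=.
case: (free_at i.+1).
  by transitivity #|'I_2|; [exact: eq_card | rewrite card_ord].
by transitivity #|pred1 (ord0 : 'I_2)|; [exact: eq_card | exact: card1].
Qed.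

Section block_set.
Context {R : realType}.
Local Notation X := (shift_space R ('I_4 * 'I_2)%type).
Local Notation Y := (shift_space R 'I_2).
Local Notation Omega := (block_set R).
Local Notation pi := (proj_snd R).

Lemma block_setP (x : X) : Omega x <-> forall i, free_at i.+1 || (x i == sym0).
Proof.
split=> [xO i|xP i /(introN (free_atP (ltn0Sn i))) fi]; last first.
  by have := xP i; rewrite (negbTE fi) => /eqP.
case: (boolP (free_at i.+1)) => //= fi; apply/eqP/xO.
exact/(elimN (free_atP _)).
Qed.

Lemma block_set_closed (x : X) :
  (forall m, exists2 y : nat -> 'I_4 * 'I_2, Omega y & agree m x y) -> Omega x.
Proof.
move=> xP; apply/block_setP => i; have [y /block_setP yO xy] := xP i.+1.
by rewrite xy.
Qed.

Lemma cyl_wordsP N x a b (w : {ffun 'I_N -> 'I_4 * 'I_2}) :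
  (a <= N)%N -> (b <= N)%N ->
  cyl_words x a b w <->
  [/\ Omega (pad sym0 w), agree a (pad sym0 w) x
    & agree b (pi (pad sym0 w)) (pi x)].
Proof.
move=> aN bN; split=> [/familyP wP|[/block_setP w0 wa wb]].
  split; first apply/block_setP => i.
  - case: (ltnP i N) => iN; last by rewrite pad_out// eqxx orbT.
    by rewrite pad_in; have := wP (Ordinal iN); rewrite !inE => /and3P[].
  - move=> i ia; have iN := leq_trans ia aN; have := wP (Ordinal iN).
    by rewrite !inE /= ia -(pad_in sym0) => /and3P[_ /eqP].
  - move=> i ib; have iN := leq_trans ib bN; have := wP (Ordinal iN).
    by rewrite !inE /= ib -(pad_in sym0) => /and3P[_ _ /eqP].
apply/familyP => i; rewrite !inE -(pad_ord sym0 w i) w0 /=.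
apply/andP; split; apply/implyP => ii; apply/eqP; first exact: wa.
exact: (wb i ii).
Qed.

End block_set.

(** * Feng-Huang entropy *)

Section FH.
Context {R : realType}.
Local Notation X := (shift_space R ('I_4 * 'I_2)%type).
Local Notation Y := (shift_space R 'I_2).
Local Notation T := (@shift_map R ('I_4 * 'I_2)%type).
Local Notation S := (@shift_map R 'I_2).
Local Notation Omega := (block_set R).
Local Notation pi := (proj_snd R).
Local Notation w := (2^-1 : R).

Lemma expR_ln2 n : expR (- ln 2 * n%:R) = 2 ^- n :> R.
Proof. by rewrite expRM_natr expRN lnK ?posrE// exprVn. Qed.

Lemma weighted_ballP n p eps (x y : X) : (0 < n)%N -> scale_of eps p ->
  weighted_ball T S pi w n x eps y <->
  agree (uphalf n + p) x y /\ agree (n + p) (pi x) (pi y).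
Proof.
move=> n0 eps_p; rewrite /weighted_ball /weighted_dist /= ceil_half gt_max.
have n0' : (0 < uphalf n)%N by rewrite uphalf_gt0.
split=> [/andP[/(bowen_dist_lt _ _ n0' eps_p) xy]|].
  by move=> /(bowen_dist_lt _ _ n0 eps_p).
move=> [xy pxy]; apply/andP; split; first exact/(bowen_dist_lt _ _ n0' eps_p).
exact/(bowen_dist_lt _ _ n0 eps_p).
Qed.

(** Number of free bits fixed by a weighted ball of order [n]. *)
Definition cyl_expo n p := (2 * nfree (uphalf n + p) + nfree (n + p))%N.

(** The first component is read up to [uphalf n + p] rather than [(n + p)./2]; as
[nfree] is 1-Lipschitz, this changes [nfree_weighted] by an amount bounded in terms of
[p] only. *)
Lemma cyl_expo_bounds n p : (n <= cyl_expo n p <= n + 3 * p.+1)%N.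
Proof.
have := nfree_weighted (n + p); have e := odd_double_half n.
have e' := odd_double_half (n + p).
have h := uphalf_half n.
have e2 : ((n + p)./2 + (uphalf n + p - (n + p)./2) = uphalf n + p)%N by lia.
have := nfree_leD (n + p)./2 (uphalf n + p - (n + p)./2).
by rewrite e2 /cyl_expo; lia.
Qed.

(** Mass distribution principle, for the normalized counting measure on the words
of length [M], where [M] is so large that such a word decides the membership in
each ball of the cover. *)
Lemma finite_mass_distribution (s : seq nat) (x : nat -> X) (n : nat -> nat) p :
  Omega `<=` \bigcup_(i in [set` s])
    [set y | agree (uphalf (n i) + p) (x i) y /\
      agree (n i + p) (pi (x i)) (pi y)] ->
  1 <= \sum_(i <- s) (2 ^- n i : R).
Proof.
move=> cov; pose M := \max_(i <- s) (n i + p)%N.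
have nM i : i \in s -> (n i + p <= M)%N.
  by move=> iF; apply: (@leq_bigmax_seq _ s xpredT (fun i => n i + p)%N).
pose W := @cyl_words M (fun=> sym0) 0 0.
pose B i := @cyl_words M (x i) (uphalf (n i) + p) (n i + p).
have upM i : i \in s -> (uphalf (n i) + p <= n i + p <= M)%N.
  by move=> /nM ->; rewrite leq_add2r leq_uphalf_double; lia.
have cardW : #|W| = (2 ^ (3 * nfree M))%N.
  rewrite -(@card_cyl_words_eq M (fun=> sym0) 0 0) ?nfree0 ?muln1//.
  by move=> i _; rewrite eqxx orbT.
(* The union bound, as a double counting of the pairs (word, ball). *)
have WB : (#|W| <= \sum_(i <- s) #|B i|)%N.
  rewrite -sum1_card; under [leqRHS]eq_bigr do rewrite -sum1_card big_mkcond.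
  rewrite exchange_big /= big_mkcond /=; apply: leq_sum => u _.
  case: ifPn => // Wu.
  have WP := @cyl_wordsP R M (fun=> sym0) 0 0 u (leq0n _) (leq0n _).
  have [u0 _ _] := WP.1 Wu.
  have [i /= iF [xu pxu]] := cov _ u0.
  rewrite (big_rem i)//= ifT// -[u \in _]/(B i u).
  have [a b] := andP (upM _ iF).
  apply/(@cyl_wordsP R M (x i) _ _ u (leq_trans a b) b).
  by split=> // k kn; [rewrite xu | rewrite pxu].
have W0 : 0 < (2 ^ (3 * nfree M))%N%:R :> R by rewrite ltr0n expn_gt0.
rewrite -(ler_pM2r W0) mul1r mulr_suml -{1}cardW.
rewrite -(ler_nat R) in WB; apply: le_trans WB _; rewrite natr_sum.
rewrite big_seq [leRHS]big_seq; apply: ler_sum => i iF.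
have /(card_cyl_words_le (x i)) := upM _ iF.
rewrite -/(cyl_expo _ _) -/(B i) -(ler_nat R) natrM !natrX => h.
rewrite ler_pdivlMl ?exprn_gt0// mulrC; apply: le_trans h.
rewrite ler_wpM2l// ler_weXn2l// ?ler1n//.
by case/andP: (cyl_expo_bounds (n i) p).
Qed.

Lemma FH_measure_ge1 eps p : scale_of eps p ->
  (1 <= FH_measure T S pi w Omega (ln 2) eps)%E.
Proof.
move=> eps_p.
apply: (le_trans _ (FH_premeasure_le T S pi w Omega (ln 2) eps 1)).
apply: le_ereal_inf_tmp => _ [J [x [n [[nJ cov] ->]]]].
pose B i := [set y : nat -> 'I_4 * 'I_2 | agree (uphalf (n i) + p) (x i) y /\
    agree (n i + p) (pi (x i)) (pi y)].
have [||y Oy|F [finF FJ covF]] := @finite_subcover _ Omega J B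
    (fun i => uphalf (n i) + n i + p)%N.
- exact: block_set_closed.
- move=> i y z _ yz [xy pxy]; split=> k kn.
    by rewrite xy// yz//; lia.
  by rewrite pxy// /proj_snd yz//; lia.
- have [i Ji By] := cov _ Oy; exists i => //.
  exact/(weighted_ballP _ _ (nJ _ Ji) eps_p).
have [s Fs] := (finite_seqP F).1 finF.
have {}Fs : F = [set` undup s].
  by rewrite Fs; apply/seteqP; split=> i /=; rewrite mem_undup.
apply: esum_ge; exists F; first by split.
rewrite Fs -fsbig_seq ?undup_uniq// sumEFin lee_fin.
under eq_bigr do rewrite expR_ln2.
by apply: (finite_mass_distribution (x := x) (p := p)); rewrite -Fs.
Qed.

(** The cover by all the balls of order exactly [N], one for each canonical
centre. *)
Lemma FH_premeasure_le_exp N eps p : (0 < N)%N -> scale_of eps p ->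
  (FH_premeasure T S pi w Omega N (ln 2) eps <= (2 ^+ (3 * p.+1))%:E)%E.
Proof.
move=> N0 eps_p; pose a := (uphalf N + p)%N.
have aN : (a <= N + p)%N by rewrite leq_add2r leq_uphalf_double; lia.
pose W := @ball_words (N + p) a.
pose w0 : {ffun 'I_(N + p) -> 'I_4 * 'I_2} := [ffun=> sym0].
pose x j : X := pad sym0 (nth w0 (enum W) j).
apply: (@le_trans _ _ (#|W|%:R * 2 ^- N)%:E); last first.
  rewrite card_ball_words// -/(cyl_expo N p) lee_fin natrX.
  rewrite ler_pdivrMr ?exprn_gt0//.
  rewrite -exprD ler_weXn2l ?ler1n//.
  by rewrite addnC; case/andP: (cyl_expo_bounds N p).
apply: ereal_inf_lbound; exists `I_#|W|, x, (fun=> N); split; first split=> //.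
  move=> y /block_setP yO.
  pose u : {ffun 'I_(N + p) -> 'I_4 * 'I_2} :=
    [ffun i : 'I_(N + p) => if (i < a)%N then y i else (ord0, (y i).2)].
  have Wu : u \in W.
    apply/familyP => i; rewrite !inE ffunE.
    have := yO i; case: ltnP => ia /=; first by rewrite andbT.
    by rewrite andbT; case: (free_at _) => //= /eqP ->.
  exists (index u (enum W)) => /=; first by rewrite cardE index_mem mem_enum.
  apply/(weighted_ballP _ _ N0 eps_p); rewrite /x nth_index ?mem_enum//.
  split=> i ia; rewrite /proj_snd.
    by rewrite (pad_in _ _ (leq_trans ia aN)) ffunE /= ia.
  by rewrite (pad_in _ _ ia) ffunE /=; case: ifP.
rewrite esum_fset//= -fsbig_ord sumEFin expR_ln2 sumr_const card_ord.
by rewrite mulr_natl.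
Qed.

Lemma FH_measure_le_exp eps p : scale_of eps p ->
  (FH_measure T S pi w Omega (ln 2) eps <= (2 ^+ (3 * p.+1))%:E)%E.
Proof.
move=> eps_p; apply: lime_le; first exact: FH_premeasure_cvg.
near=> N; apply: FH_premeasure_le_exp eps_p.
by near: N; exact: nbhs_infty_gt.
Unshelve. all: by end_near. Qed.

(** At [s = ln 2] the measure is neither [0] nor infinite, so [ln 2] is the
critical value. *)
Lemma FH_entropy_epsE eps p : scale_of eps p ->
  FH_entropy_eps T S pi w Omega eps = (ln 2)%:E.
Proof.
move=> eps_p.
have Mfin : (FH_measure T S pi w Omega (ln 2) eps < +oo)%E.
  exact: le_lt_trans (FH_measure_le_exp eps_p) (ltry _).
have Mge1 := FH_measure_ge1 eps_p.
apply: (FH_critical_unique (FH_entropy_epsP T S pi w Omega eps)).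
split; first by rewrite lee_fin ln_ge0// ler1n.
move=> s s0; rewrite !lte_fin; split=> s2; last exact: FH_measure_eq0 s2 Mfin.
apply/eqP; rewrite -leye_eq leNgt; apply/negP => /(FH_measure_eq0 s2) M0.
by move: Mge1; rewrite M0 lee_fin ler10.
Qed.

Lemma lim_scale (f : R -> \bar R) l :
  (forall eps p, scale_of eps p -> f eps = l) ->
  lim (f eps @[eps --> 0^'+]) = l.
Proof.
move=> fl; apply: cvg_lim => //; apply: cvg_near_cst.
near=> eps.
have [||p eps_p] := @scale_exists R eps.
- by near: eps; exact: nbhs_right_gt.
- by near: eps; apply: nbhs_right_le; rewrite invr_gt0.
exact: fl eps_p.
Unshelve. all: by end_near. Qed.

End FH.

(** * Weighted covering numbers *)

(** Counting lower bound for coverings: points that no piece [Q j] contains two of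
are sent injectively to the pieces. *)
Lemma injective_selection (I : finType) (P : pred I) (k : nat)
    (Q : 'I_k -> I -> Prop) :
  (forall i, P i -> exists j, Q j i) ->
  (forall j a b, P a -> P b -> Q j a -> Q j b -> a = b) ->
  exists f : {i | P i} -> 'I_k, injective f /\ forall i, Q (f i) (val i).
Proof.
move=> PQ Q_inj.
have /choice[f fQ] : forall i : {i | P i}, exists j, Q j (val i).
  by move=> [i Pi]; apply: PQ.
exists f; split=> // a b fab; apply/val_inj/(Q_inj (f a)).
- exact: valP.
- exact: valP.
- exact: fQ.
- by rewrite fab; apply: fQ.
Qed.

Section covering.
Context {R : realType}.
Local Notation X := (shift_space R ('I_4 * 'I_2)%type).
Local Notation Y := (shift_space R 'I_2).
Local Notation T := (@shift_map R ('I_4 * 'I_2)%type).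
Local Notation S := (@shift_map R 'I_2).
Local Notation Omega := (block_set R).
Local Notation pi := (proj_snd R).
Local Notation w := (2^-1 : R).

(** A section of the projection, which maps [pi Omega] into [Omega]. *)
Definition lift0 (y : nat -> 'I_2) : nat -> 'I_4 * 'I_2 := fun i => (ord0, y i).

Lemma base_wordsP N (v : {ffun 'I_N -> 'I_2}) :
  base_words v <-> Omega (lift0 (pad ord0 v)).
Proof.
split=> [/familyP vP|/block_setP vP].
  apply/block_setP => i; rewrite /lift0 xpair_eqE eqxx /=.
  case: (ltnP i N) => iN; last by rewrite pad_out// eqxx orbT.
  by rewrite pad_in; have := vP (Ordinal iN); rewrite !inE.
apply/familyP => i; have := vP i.
by rewrite /lift0 xpair_eqE eqxx /= pad_ord !inE.
Qed.

Lemma card_fibre_words N (v : {ffun 'I_N -> 'I_2}) : base_words v ->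
  #|@cyl_words N (lift0 (pad ord0 v)) 0 N| = (2 ^ (2 * nfree N))%N.
Proof.
move=> /base_wordsP/block_setP vP; apply/eqP.
rewrite -(eqn_pmul2r (expn_gt0 2 (2 * nfree 0 + nfree N))).
rewrite card_cyl_words_eq ?leqnn// nfree0 -expnD; apply/eqP; congr expn; lia.
Qed.

(** It is enough that the open set [V] contains the single point [pad ord0 v]: the
words of the fibre over that point are already separated. *)
Lemma covering_number_fibre_ge N n eps p (v : {ffun 'I_N -> 'I_2}) (V : set Y) :
  (0 < n)%N -> N = (n + p)%N -> scale_of eps p ->
  base_words v -> V (pad ord0 v) ->
  ((2 ^ (2 * nfree N))%:R%:E <=
    covering_number T (Omega `&` pi @^-1` V) n eps)%E.
Proof.
move=> n0 NE eps_p vW Vv; apply: le_ereal_inf_tmp => _ [k [U [_ cov diam]] <-].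
rewrite lee_fin ler_nat -(card_fibre_words vW).
have [||f [f_inj _]] := @injective_selection _
    (@cyl_words N (lift0 (pad ord0 v)) 0 N) k (fun j u => U j (pad sym0 u : X)).
- move=> u /(@cyl_wordsP R N _ 0 N u (leq0n _) (leqnn _))[uO _ upi].
  have [|j _ Uj] := cov (pad sym0 u); last by exists j.
  split=> //=; congr (V _): Vv; apply/funext => i.
  case: (ltnP i N) => [iN|Ni]; first by rewrite upi.
  by rewrite /proj_snd !pad_out.
- move=> j a b _ _ Ua Ub; rewrite -(truncate_pad sym0 a) -(truncate_pad sym0 b).
  have := (bowen_diam_lt _ n0 eps_p).1 (diam j); rewrite -NE => agreeU.
  exact/agree_truncate/agreeU.
by have := leq_card f f_inj; rewrite card_sig card_ord; apply: leq_trans;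
  rewrite leq_eqVlt; apply/orP; left; apply/eqP/eq_card.
Qed.

Lemma covering_number_fibre_le N n eps p (v : {ffun 'I_N -> 'I_2}) :
  (0 < n)%N -> N = (n + p)%N -> scale_of eps p -> base_words v ->
  (covering_number T (Omega `&` pi @^-1` [set y | agree N (pad ord0 v) y]) n eps
    <= (2 ^ (2 * nfree N))%:R%:E)%E.
Proof.
move=> n0 NE eps_p vW; rewrite -(card_fibre_words vW).
set W := cyl_words _ _ _; apply: ereal_inf_lbound; exists #|W| => //.
exists (fun i : 'I_#|W| => [set x : X | agree N (pad sym0 (enum_val i)) x]).
split.
- by move=> i; apply: open_agree.
- move=> x [xO /= vx].
  have Wx : truncate N x \in W.
    apply/(@cyl_wordsP R N _ 0 N _ (leq0n _) (leqnn _)); split=> //.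
      apply/block_setP => i; case: (ltnP i N) => iN.
        by rewrite (agree_pad_truncate sym0 x iN); move/block_setP : xO; apply.
      by rewrite pad_out// eqxx orbT.
    move=> i iN; rewrite /proj_snd (agree_pad_truncate sym0 x iN) /lift0 /=.
    by rewrite (vx _ iN).
  exists (enum_rank_in Wx (truncate N x)) => //=.
  by rewrite enum_rankK_in//; apply: agree_pad_truncate.
move=> i; apply/(bowen_diam_lt _ n0 eps_p) => x y /= xi yi; rewrite -NE => k kN.
by rewrite -xi// -yi.
Qed.

Lemma poweR_half k : ((2 ^ (2 * k))%:R%:E `^ w = (2 ^ k)%:R%:E :> \bar R)%E.
Proof.
rewrite poweR_EFin powR12_sqrt// mulnC expnM natrX sqrtr_sqr.
by rewrite ger0_norm.
Qed.

(** Upper bound: the [2 ^ nfree N] cylinders of length [N = n + p], each of weight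
[2 ^ nfree N].  Lower bound: the [2 ^ nfree N] points [pad ord0 v] lie in
distinct sets [V j], and each of these sets has at least that weight. *)
Lemma weighted_covering_numberE n p eps : (0 < n)%N -> scale_of eps p ->
  weighted_covering_number T S pi w Omega n eps =
  (2 ^ (2 * nfree (n + p)))%:R%:E.
Proof.
move=> n0 eps_p; pose N := (n + p)%N; pose W := @base_words N.
rewrite -/N; apply/eqP; rewrite eq_le; apply/andP; split.
  pose V (j : 'I_#|W|) := [set y : Y | agree N (pad ord0 (enum_val j)) y].
  apply: (@le_trans _ _ (\sum_(j < #|W|) (2 ^ nfree N)%:R%:E)%E); last first.
    rewrite sumEFin sumr_const card_ord card_base_words lee_fin.
    by rewrite -mulrnA -expnD addnn mul2n.
  apply: ge_ereal_inf; eexists.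
    exists #|W|, V; split; last by [].
    - by move=> j; apply: open_agree.
    - move=> _ [x /block_setP xO <-].
      have Wx : truncate N (pi x) \in W.
        apply/familyP => i; rewrite !inE ffunE /proj_snd.
        by have := xO i; case: (free_at _) => //= /eqP ->.
      exists (enum_rank_in Wx (truncate N (pi x))) => //.
      by rewrite /V /= enum_rankK_in//; apply: agree_pad_truncate.
    move=> j; apply/(bowen_diam_lt _ n0 eps_p) => x y /= xi yi k kN.
    by rewrite -xi// -yi.
  apply: lee_sum => j _; case: ifP => _; first by rewrite lee_fin.
  rewrite -poweR_half; apply: gt0_ler_poweR; rewrite ?in_itv/= ?leey ?andbT//.
  - by apply: le_ereal_inf_tmp => _ [k _ <-]; rewrite lee_fin.
  - exact: (covering_number_fibre_le n0 (erefl N) eps_p (enum_valP j)).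
apply: le_ereal_inf_tmp => _ [l [V [_ cov diam ->]]].
have [||f [f_inj fV]] := @injective_selection _ W l
    (fun j v => V j (pad ord0 v : Y)).
- move=> v /base_wordsP vO.
  have [|j _ Vj] := cov (pad ord0 v); last by exists j.
  by exists (lift0 (pad ord0 v)).
- move=> j a b _ _ Va Vb; rewrite -(truncate_pad ord0 a) -(truncate_pad ord0 b).
  exact/agree_truncate/((bowen_diam_lt _ n0 eps_p).1 (diam j)).
pose t j := (if `[< Omega `&` pi @^-1` V j = set0 >] then 0
  else covering_number T (Omega `&` pi @^-1` V j) n eps `^ w)%E.
apply: (@le_trans _ _ (\sum_(j < l) t j)%E) => //.
have t_ge0 j : (0 <= t j)%E by rewrite /t; case: ifP => // _; apply: poweR_ge0.
have t_ge v : ((2 ^ nfree N)%:R%:E <= t (f v))%E.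
  rewrite /t; case: asboolP => [V0|_].
    have : (Omega `&` pi @^-1` V (f v)) (lift0 (pad ord0 (val v)) : X).
      by split; [exact/base_wordsP/(valP v) | exact: fV].
    by rewrite V0.
  have cov_ge := covering_number_fibre_ge n0 (erefl N) eps_p (valP v) (fV v).
  rewrite -poweR_half; apply: gt0_ler_poweR => //; rewrite in_itv/= leey andbT.
  - by rewrite lee_fin.
  - by apply: le_trans cov_ge; rewrite lee_fin.
apply: (@le_trans _ _ (\sum_(v : {v | W v}) t (f v))%E).
  apply: (@le_trans _ _ (\sum_(v : {v | W v}) (2 ^ nfree N)%:R%:E)%E).
    rewrite sumEFin sumr_const lee_fin -mulrnA mul2n -addnn expnD.
    rewrite ler_nat leq_mul2l; apply/orP; right.
    by rewrite card_sig -card_base_words; apply/eq_leq/eq_card.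
  by apply: lee_sum.
rewrite -(big_imset t (in2W f_inj)) /=.
rewrite (eq_bigl (fun j => xpredT j && (j \in imset f (mem {: {v | W v}}))))//.
by apply: lee_sum_nneg.
Qed.

End covering.

(** * Lower and upper growth rates *)

(** Used for both limits, up to sign: [v] bounds [u] on one side, converges, and is
met by [u] infinitely often. *)
Lemma limn_esup_touching (R : realType) (u v : R^nat) (l : R) :
  v @ \oo --> l -> (\forall n \near \oo, u n <= v n) ->
  (forall N, exists2 n, (N <= n)%N & v n <= u n) ->
  limn_esup (fun n => (u n)%:E) = l%:E.
Proof.
move=> vl uv vu; apply/eqP; rewrite eq_le; apply/andP; split.
  apply/lee_addgt0Pr => e e0.
  have uV : \forall n \near \oo, u n <= l + e.
    near=> n; apply: (@le_trans _ _ (v n)); first by near: n.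
    by near: n; apply: (cvgr_le _ vl); rewrite ltrDl.
  apply: ge_ereal_inf.
  exists (ereal_sup [set (u n)%:E | n in [set n | u n <= l + e]]).
    by exists [set n | u n <= l + e].
  by apply: ge_ereal_sup => _ [n nV <-]; rewrite lee_fin.
apply: le_ereal_inf_tmp => _ [V [N _ NV] <-]; apply/lee_subgt0Pr => e e0.
have [M _ vM] : \forall n \near \oo, l - e <= v n.
  by apply: (cvgr_ge _ vl); rewrite ltrBlDr ltrDl.
have [n nMN vun] := vu (maxn M N).
apply: (@le_trans _ _ (u n)%:E); last first.
  apply: ereal_sup_ubound; exists n => //; apply: NV => /=.
  by rewrite (leq_trans _ nMN)// leq_maxr.
rewrite lee_fin (le_trans _ vun)//; apply: vM => /=.
by rewrite (leq_trans _ nMN)// leq_maxl.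
Unshelve. all: by end_near. Qed.

Lemma cvg_affine_divn (R : realType) (a b : nat) :
  (a * n + b)%:R / n%:R @[n --> \oo] --> (a%:R : R).
Proof.
have n_gt0 : \forall n \near \oo, 0 < n%:R :> R.
  by near=> n; rewrite ltr0n; near: n; exact: nbhs_infty_gt.
have : a%:R + b%:R * n%:R^-1 @[n --> \oo] --> (a%:R + b%:R * 0 : R).
  apply: cvgD; first exact: cvg_cst.
  apply: cvgM; first exact: cvg_cst.
  by apply/gtr0_cvgV0; [exact: n_gt0 | exact: cvgr_idn].
rewrite mulr0 addr0; apply: cvg_trans; apply: near_eq_cvg.
near=> n; rewrite natrD mulrDl natrM mulfK//.
by apply: lt0r_neq0; near: n.
Unshelve. all: by end_near. Qed.

Section growth.
Context {R : realType}.
Local Notation T := (@shift_map R ('I_4 * 'I_2)%type).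
Local Notation S := (@shift_map R 'I_2).
Local Notation Omega := (block_set R).
Local Notation pi := (proj_snd R).
Local Notation w := (2^-1 : R).

Definition growth p n : R := ln 2 * (2 * nfree (n + p))%:R / n%:R.

Lemma growthE eps p : scale_of eps p ->
  (fun n => (lne (weighted_covering_number T S pi w Omega n eps)
    * (n%:R^-1)%:E)%E) = (fun n => (growth p n)%:E).
Proof.
(* At [n = 0] both sides vanish, as [0^-1 = 0]. *)
move=> eps_p; apply/funext => -[|n]; first by rewrite /growth invr0 mulr0 mule0.
rewrite (weighted_covering_numberE _ eps_p)// /= leNgt ltr0n expn_gt0 /=.
by rewrite natrX lnXn ?ltr0n// -EFinM /growth mulr_natr.
Qed.

Lemma growth_nfree p n :
  growth p n = 2 / 3 * ln 2 * ((3 * nfree (n + p))%:R / n%:R).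
Proof. by rewrite /growth !natrM; lra. Qed.

Lemma cvg_growth_bound a b :
  2 / 3 * ln 2 * ((a * n + b)%:R / n%:R) @[n --> \oo] -->
  2 / 3 * ln 2 * (a%:R : R).
Proof. by apply: cvgM; [exact: cvg_cst | exact: cvg_affine_divn]. Qed.

Lemma ln2_gt0 : 0 < ln 2 :> R.
Proof. by rewrite ln_gt0// ltr1n. Qed.

Lemma growth_scale (k m n : nat) : (k <= m)%N ->
  2 / 3 * ln 2 * (k%:R / n%:R) <= 2 / 3 * ln 2 * (m%:R / n%:R) :> R.
Proof.
move=> km; apply: ler_wpM2l; first by have := ln2_gt0; lra.
by rewrite ler_wpM2r ?invr_ge0// ler_nat.
Qed.

Lemma limn_esup_growth p :
  limn_esup (fun n => (growth p n)%:E) = (4 / 3 * ln 2)%:E.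
Proof.
have -> : 4 / 3 * ln 2 = 2 / 3 * ln 2 * 2%:R :> R by lra.
apply: (limn_esup_touching (@cvg_growth_bound 2 (2 * p + 1))).
  apply: nearW => n; rewrite growth_nfree; apply: growth_scale.
  by have := nfree_bounds (n + p); lia.
move=> N; have [_ [m Nm m_max]] := nfree_extremal (N + p).
exists (m - p)%N; first by lia.
by rewrite growth_nfree; apply: growth_scale; rewrite subnK; lia.
Qed.

Lemma limn_einf_growth p :
  limn_einf (fun n => (growth p n)%:E) = (2 / 3 * ln 2)%:E.
Proof.
have -> : 2 / 3 * ln 2 = 2 / 3 * ln 2 * 1%:R :> R by rewrite mulr1.
rewrite /limn_einf -[RHS]oppeK; congr (- _)%E.
apply: (limn_esup_touching (u := fun n => - growth p n)
  (cvgN (@cvg_growth_bound 1 p))).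
  apply: nearW => n; rewrite /= lerN2 growth_nfree; apply: growth_scale.
  by have := nfree_bounds (n + p); lia.
move=> N; have [[m Nm m_min] _] := nfree_extremal (N + p).
exists (m - p)%N; first by lia.
by rewrite /= lerN2 growth_nfree; apply: growth_scale; rewrite subnK; lia.
Qed.

End growth.

Theorem proposition4p2 (R : realType) :
  let X := shift_space R ('I_4 * 'I_2)%type in
  let Y := shift_space R 'I_2 in
  let T : X -> X := shift_map in
  let S : Y -> Y := shift_map in
  let pi : X -> Y := proj_snd R in
  let Omega : set X := block_set R in
  let w : R := 2^-1 in
  [/\ FH_entropy T S pi w Omega = (ln 2)%:E,
      lower_top_entropy T S pi w Omega = (2 / 3 * ln 2)%:E,
      (lower_top_entropy T S pi w Omega < FH_entropy T S pi w Omega)%E,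
      (FH_entropy T S pi w Omega < upper_top_entropy T S pi w Omega)%E
    & upper_top_entropy T S pi w Omega = (4 / 3 * ln 2)%:E].
Proof.
move=> X Y T S pi Omega w.
have FH : FH_entropy T S pi w Omega = (ln 2)%:E.
  by apply: lim_scale => eps p; apply: FH_entropy_epsE.
have lower : lower_top_entropy T S pi w Omega = (2 / 3 * ln 2)%:E.
  by apply: lim_scale => eps p /growthE ->; apply: limn_einf_growth.
have upper : upper_top_entropy T S pi w Omega = (4 / 3 * ln 2)%:E.
  by apply: lim_scale => eps p /growthE ->; apply: limn_esup_growth.
have ln2 := @ln2_gt0 R.
by rewrite FH lower upper !lte_fin; split=> //; lra.
Qed.
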